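(* $$R_{\mathrm{can}}(\mathfrak O)=\frac1{\sqrt3}.$$
   Context: $\mathfrak O:=\{(x,y)\in[0,1]^2: x+y\le\sqrt2\}$. For $r>0$ write $r\mathfrak O:=\{rz: z\in\mathfrak O\}$. For a real quadratic form $Q$ in two variables put $\|Q\|_{\mathfrak O}:=\sup_{z\in\mathfrak O}|Q(z)|$ and $\|Q\|_{r\mathfrak O}:=\sup_{z\in r\mathfrak O}|Q(z)|$. For $P(x,y)=ax^2+bxy+cy^2$ with $a,b,c\in\mathbb R$, the coefficient modulus polynomial is $P^\#(x,y):=|a|x^2+|b|xy+|c|y^2$. The canonical body-relative Bohr radius is $$R_{\mathrm{can}}(\mathfrak O):=\sup\{r>0:\ \|P^\#\|_{r\mathfrak O}\le1\text{ for every real quadratic form }P\text{ with }\|P\|_{\mathfrak O}\le1\}.$$ *)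

(* Defs.v *)
From HB Require Import structures.
From mathcomp Require Import all_boot all_order all_algebra.
From mathcomp Require Import classical_sets reals.

Set Implicit Arguments.
Unset Strict Implicit.
Unset Printing Implicit Defensive.

Import Order.TTheory GRing.Theory Num.Theory.
Local Open Scope classical_set_scope.
Local Open Scope ring_scope.

(* The form a x^2 + b x y + c y^2, given by its coefficients. *)
Record quad_form (R : realType) := QuadForm {
  coef_xx : R;
  coef_xy : R;
  coef_yy : R }.

Definition qf_eval (R : realType) (Q : quad_form R) (z : R * R) : R :=
  coef_xx Q * z.1 ^+ 2 + coef_xy Q * z.1 * z.2 + coef_yy Q * z.2 ^+ 2.

Definition coef_modulus (R : realType) (Q : quad_form R) : quad_form R :=
  QuadForm `|coef_xx Q| `|coef_xy Q| `|coef_yy Q|.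

Definition octagon_body (R : realType) : set (R * R) :=
  [set z | [/\ 0 <= z.1 <= 1, 0 <= z.2 <= 1 & z.1 + z.2 <= Num.sqrt 2]].

Definition dilate (R : realType) (r : R) (K : set (R * R)) : set (R * R) :=
  [set (r * z.1, r * z.2) | z in K].

(* [sup] is the least upper bound only for nonempty sets that are bounded
   above (it is 0 otherwise); this holds whenever K is nonempty and bounded,
   in particular for the dilates of [octagon_body R]. *)
Definition sup_norm (R : realType) (K : set (R * R)) (Q : quad_form R) : R :=
  sup [set `|qf_eval Q z| | z in K].

Definition bohr_radius_can (R : realType) (K : set (R * R)) : R :=
  sup [set r : R | 0 < r /\
    forall P : quad_form R, sup_norm K P <= 1 ->
      sup_norm (dilate r K) (coef_modulus P) <= 1].

(* Main.v *)
Require Import Defs.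
From HB Require Import structures.
From mathcomp Require Import all_boot all_order all_algebra.
From mathcomp Require Import classical_sets reals.
From mathcomp Require Import ring lra.

Set Implicit Arguments.
Unset Strict Implicit.
Unset Printing Implicit Defensive.

Import Order.TTheory GRing.Theory Num.Theory.
Local Open Scope ring_scope.

(** If [|P| <= 1] on the body for [P = a x^2 + b x y + c y^2], then evaluating
    at [(1, 0)], [(0, 1)] and [(1/sqrt 2, 1/sqrt 2)] gives [|a|, |c| <= 1] and
    [|a + b + c| <= 2], hence [|b| <= 4].  So
    [P^# <= x^2 + 4 x y + y^2 = (x + y)^2 + 2 x y <= 2 + 1] on the body, and by
    homogeneity [P^# <= 3 r^2] on its dilate by [r].  Equality holds for
    [x^2 - 4 x y + y^2] at [(1/sqrt 2, 1/sqrt 2)]. *)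

Section SupNorm.
Variable R : realType.
Implicit Types (K : set (R * R)) (Q : quad_form R) (z : R * R).

Lemma sup_norm_le K Q (C : R) : (K !=set0)%classic ->
  (forall z, K z -> `|qf_eval Q z| <= C) -> sup_norm K Q <= C.
Proof.
move=> [z0 Kz0] leC; apply: ge_sup; first by exists `|qf_eval Q z0|, z0.
by move=> _ [z Kz <-]; exact: leC.
Qed.

(** The bound [C] certifies that the set of values is bounded, so that [sup] is a true supremum and
    not its default 0; any finite constant serves. *)
Lemma qf_eval_le_sup_norm K Q (C : R) z :
  (forall w, K w -> `|qf_eval Q w| <= C) -> K z ->
  `|qf_eval Q z| <= sup_norm K Q.
Proof.
move=> leC Kz; apply: ub_le_sup; last by exists z.
by exists C => _ [w Kw <-]; exact: leC.
Qed.

Lemma qf_eval_dilate Q (r : R) z :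
  qf_eval Q (r * z.1, r * z.2) = r ^+ 2 * qf_eval Q z.
Proof. by rewrite /qf_eval /=; ring. Qed.

Lemma le_qf_eval_coef_modulus Q z : 0 <= z.1 -> 0 <= z.2 ->
  `|qf_eval Q z| <= qf_eval (coef_modulus Q) z.
Proof.
move=> x0 y0; rewrite /qf_eval /=.
have -> : `|coef_xx Q| * z.1 ^+ 2 = `|coef_xx Q * z.1 ^+ 2|.
  by rewrite normrM (ger0_norm (sqr_ge0 _)).
have -> : `|coef_yy Q| * z.2 ^+ 2 = `|coef_yy Q * z.2 ^+ 2|.
  by rewrite normrM (ger0_norm (sqr_ge0 _)).
have -> : `|coef_xy Q| * z.1 * z.2 = `|coef_xy Q * z.1 * z.2|.
  by rewrite !normrM (ger0_norm x0) (ger0_norm y0).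
by apply: le_trans (ler_normD _ _) _; rewrite lerD2r ler_normD.
Qed.

End SupNorm.

Section Octagon.
Variable R : realType.
Implicit Types (Q : quad_form R) (z : R * R).
Local Notation s2 := (Num.sqrt (2 : R)).
Local Notation octagon := (@octagon_body R).

Lemma sqr_sqrt2 : s2 ^+ 2 = 2.
Proof. by rewrite sqr_sqrtr // ler0n. Qed.

(** The lower bound puts [(1, 0)] and [(0, 1)] under the line [x + y = s2]; the upper one keeps
    [(s2 / 2, s2 / 2)] inside the unit square. *)
Lemma sqrt2_bounds : 1 <= s2 <= 2.
Proof.
have := sqr_sqrt2; have : 0 <= s2 by exact: sqrtr_ge0.
by move=> ? ?; apply/andP; split; nra.
Qed.

Lemma octagon_e1 : octagon (1, 0).
Proof. by have /andP[? ?] := sqrt2_bounds; split=> /=; lra. Qed.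

Lemma octagon_e2 : octagon (0, 1).
Proof. by have /andP[? ?] := sqrt2_bounds; split=> /=; lra. Qed.

Lemma octagon_diag : octagon (s2 / 2, s2 / 2).
Proof. by have /andP[? ?] := sqrt2_bounds; split=> /=; lra. Qed.

Lemma octagon_sqr_le z : octagon z -> (z.1 + z.2) ^+ 2 <= 2.
Proof.
move=> [/andP[x0 _] /andP[y0 _] xy]; rewrite -sqr_sqrt2.
by rewrite ler_pXn2r // nnegrE ?addr_ge0 ?sqrtr_ge0.
Qed.

(** From [4 x y = (x + y)^2 - (x - y)^2 <= 2]. *)
Lemma octagon_mul_le z : octagon z -> z.1 * z.2 <= 1 / 2.
Proof.
move=> /octagon_sqr_le; have : 0 <= (z.1 - z.2) ^+ 2 by exact: sqr_ge0.
by rewrite sqrrB sqrrD => ? ?; lra.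
Qed.

Lemma qf_eval_diag Q :
  qf_eval Q (s2 / 2, s2 / 2) = (coef_xx Q + coef_xy Q + coef_yy Q) / 2.
Proof.
have s22 : (s2 / 2) ^+ 2 = 1 / 2 by rewrite expr_div_n sqr_sqrt2; field.
by rewrite /qf_eval /= -mulrA -expr2 s22; field.
Qed.

Lemma coef_modulus_octagon_le Q (A B C : R) z :
  `|coef_xx Q| <= A -> `|coef_xy Q| <= B -> `|coef_yy Q| <= C -> octagon z ->
  qf_eval (coef_modulus Q) z <= A * z.1 ^+ 2 + B * (z.1 * z.2) + C * z.2 ^+ 2.
Proof.
move=> leA leB leC [/andP[x0 _] /andP[y0 _] _]; rewrite /qf_eval /= -mulrA.
by rewrite !lerD // ler_wpM2r ?sqr_ge0 ?mulr_ge0.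
Qed.

(** A crude bound from [x, y <= 1], meant to supply the constant in [qf_eval_le_sup_norm]. *)
Lemma qf_eval_octagon_bounded Q z : octagon z ->
  `|qf_eval Q z| <= `|coef_xx Q| + `|coef_xy Q| + `|coef_yy Q|.
Proof.
move=> Oz; have [/andP[x0 x1] /andP[y0 y1] _] := Oz.
apply: le_trans (le_qf_eval_coef_modulus _ x0 y0) _; rewrite /qf_eval /= -mulrA.
by rewrite !lerD // ler_piMr // ?expr_le1 // mulr_ile1.
Qed.

Lemma octagon_coef_modulus_le3 Q z : sup_norm octagon Q <= 1 -> octagon z ->
  qf_eval (coef_modulus Q) z <= 3.
Proof.
move=> Q1 Oz.
have le1 w : octagon w -> `|qf_eval Q w| <= 1.
  move=> Ow; apply: le_trans Q1.
  exact: (qf_eval_le_sup_norm (@qf_eval_octagon_bounded Q)).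
have a1 : `|coef_xx Q| <= 1.
  have := le1 _ octagon_e1; rewrite /qf_eval /=.
  by rewrite expr1n expr0n /= !mulr0 mulr1 !addr0.
have c1 : `|coef_yy Q| <= 1.
  have := le1 _ octagon_e2; rewrite /qf_eval /=.
  by rewrite expr1n expr0n /= !mulr0 mul0r mulr1 !add0r.
have b4 : `|coef_xy Q| <= 4.
  have := le1 _ octagon_diag; rewrite qf_eval_diag.
  move: a1 c1; rewrite !ler_norml => /andP[? ?] /andP[? ?] /andP[? ?].
  by apply/andP; split; lra.
apply: le_trans (coef_modulus_octagon_le a1 b4 c1 Oz) _.
have := octagon_sqr_le Oz; have := octagon_mul_le Oz; nra.
Qed.

Definition extremal_form : quad_form R := QuadForm 1 (-4) 1.

Lemma sup_norm_extremal_form : sup_norm octagon extremal_form <= 1.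
Proof.
apply: sup_norm_le; first by exists (1, 0); exact: octagon_e1.
move=> z Oz; have := octagon_mul_le Oz.
have [/andP[x0 x1] /andP[y0 y1] _] := Oz; rewrite /qf_eval /= ler_norml => xy.
have sq : 0 <= (z.1 - z.2) ^+ 2 by exact: sqr_ge0.
(* Lower bound: [x^2 - 4 x y + y^2 = (x - y)^2 - 2 x y >= -1]. *)
apply/andP; split; first by nra.
(* Upper bound: if [y <= x] then [y^2 <= 4 x y], so the value is at most [x^2 <= 1]; the other case
   is symmetric. *)
by have [yx|/ltW yx] := leP z.2 z.1; nra.
Qed.

Lemma sup_norm_dilate_octagon_le Q (r : R) : sup_norm octagon Q <= 1 ->
  sup_norm (dilate r octagon) (coef_modulus Q) <= 3 * r ^+ 2.
Proof.
move=> Q1; apply: sup_norm_le.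
  by exists (r * 1, r * 0), (1, 0); first exact: octagon_e1.
move=> _ [z Oz <-]; have [/andP[x0 _] /andP[y0 _] _] := Oz.
rewrite qf_eval_dilate normrM (ger0_norm (sqr_ge0 _)) mulrC.
rewrite ler_wpM2r ?sqr_ge0 // ger0_norm; first exact: octagon_coef_modulus_le3.
(* The modulus form is nonnegative here because it dominates an absolute value. *)
exact: le_trans (normr_ge0 _) (le_qf_eval_coef_modulus _ x0 y0).
Qed.

Lemma sup_norm_dilate_extremal_form (r : R) :
  3 * r ^+ 2 <= sup_norm (dilate r octagon) (coef_modulus extremal_form).
Proof.
set Q := coef_modulus _; have <- : qf_eval Q (s2 / 2, s2 / 2) = 3.
  by rewrite qf_eval_diag /= normrN !ger0_norm ?ler0n //; field.
rewrite mulrC -qf_eval_dilate; apply: le_trans (ler_norm _) _.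
(* Homogeneity scales the crude bound on the body by [r ^+ 2], giving boundedness on the dilate. *)
apply: (@qf_eval_le_sup_norm _ _ _
  (r ^+ 2 * (`|coef_xx Q| + `|coef_xy Q| + `|coef_yy Q|))).
  move=> _ [w Ow <-]; rewrite qf_eval_dilate normrM (ger0_norm (sqr_ge0 _)).
  by rewrite ler_wpM2l ?sqr_ge0 // qf_eval_octagon_bounded.
by exists (s2 / 2, s2 / 2); first exact: octagon_diag.
Qed.

End Octagon.

Theorem corollary6p8 (R : realType) :
  bohr_radius_can (@octagon_body R) = 1 / Num.sqrt 3.
Proof.
have s3 : Num.sqrt (3 : R) ^+ 2 = 3 by rewrite sqr_sqrtr // ler0n.
have s3_gt0 : 0 < Num.sqrt (3 : R) by rewrite sqrtr_gt0 ltr0n.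
rewrite /bohr_radius_can; set S := (X in sup X).
have S_max : S (1 / Num.sqrt 3).
  split=> [|P P1]; first by rewrite divr_gt0.
  apply: le_trans (sup_norm_dilate_octagon_le _ P1) _.
  by rewrite expr_div_n s3 expr1n mul1r divff ?pnatr_eq0.
have S_ub : ubound S (1 / Num.sqrt 3).
  move=> r [r_gt0 /(_ _ (sup_norm_extremal_form R))].
  move=> /(le_trans (sup_norm_dilate_extremal_form r)) r3.
  (* Both sides of [r * sqrt 3 <= 1] are nonnegative, so it suffices to compare squares, which is
     [3 r^2 <= 1]. *)
  rewrite ler_pdivlMr // -(@ler_pXn2r _ 2) ?nnegrE ?mulr_ge0
    ?(ltW r_gt0) ?(ltW s3_gt0) //.
  by rewrite exprMn s3 expr1n mulrC.
(* [1 / sqrt 3] is the maximum of [S]: [S_max] also shows [S] nonempty and [S_ub] shows it bounded,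
   as [sup] requires. *)
apply: le_anti; apply/andP; split.
  by apply: ge_sup S_ub; exists (1 / Num.sqrt 3); exact: S_max.
by apply: ub_le_sup S_max; exists (1 / Num.sqrt 3); exact: S_ub.
Qed.
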